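(* Let $B$ be a commutative ring, let $A$ be a ring that is a free right $B$-module of rank $m$, and let $r\ge1$. If $a'\in \mathrm{M}(r,A)$ is obtained from $a\in \mathrm{M}(r,A)$ by adding a left-multiple (by an element of $A$) of a row to another row, or a right-multiple (by an element of $A$) of a column to another column, then $\mathrm{Sdet}_{\mathrm{M}(r,A)}^{B}(a')=\mathrm{Sdet}_{\mathrm{M}(r,A)}^{B}(a)$.
   Context: Rings have a multiplicative unit; $\mathrm{M}(k,R)$ is the ring of $k\times k$ matrices over $R$. ''$A$ is a free right $B$-module of rank $m$'' means that $B$ is a subring of $A$ and $A=\bigoplus_{i=1}^m e_iB$ for some ordered basis $e=(e_1,\dots,e_m)$. For such rings the left regular representation $L_e:A\to \mathrm{M}(m,B)$, $a\mapsto(b_{ij})$, is defined by $ae_j=\sum_ie_ib_{ij}$. Also $\mathrm{M}(r,A)=\bigoplus_{i=1}^m(e_iI_r)\mathrm{M}(r,B)$ is a free right $\mathrm{M}(r,B)$-module of rank $m$; let $L:\mathrm{M}(r,A)\to \mathrm{M}(m,\mathrm{M}(r,B))$ be a left regular representation (e.g. with respect to $(e_1I_r,\dots,e_mI_r)$). The Study-type determinant is $\mathrm{Sdet}_{\mathrm{M}(r,A)}^B:=\det\circ\,\iota\circ L$, where $\iota:\mathrm{M}(m,\mathrm{M}(r,B))\hookrightarrow \mathrm{M}(mr,B)$ is the inclusion (block matrices viewed as $mr\times mr$ matrices) and $\det:\mathrm{M}(mr,B)\to B$ is the determinant; it does not depend on the choice of basis. *)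

(* Defs.v *)
From HB Require Import structures.
From mathcomp Require Import all_boot all_order all_algebra.

Set Implicit Arguments.
Unset Strict Implicit.
Unset Printing Implicit Defensive.

Import GRing.Theory.
Local Open Scope ring_scope.

(* A subring B of A is presented by its inclusion f : B -> A, whose image is  *)
(* not assumed to be central in A.                                            *)
Section FreeRightModule.

Variables (A B : pzRingType) (f : B -> A) (m : nat).
Implicit Types (e : 'I_m -> A) (a : A) (b : {ffun 'I_m -> B}).

Definition right_basis e : Prop :=
  forall a, exists! b, a = \sum_(i < m) e i * f (b i).

Definition free_right_rank : Prop := exists e, right_basis e.

Fact coords_subproof e (he : right_basis e) a :
  exists b, a == \sum_(i < m) e i * f (b i).
Proof. by have [b [/eqP hb _]] := he a; exists b. Qed.

Definition coords e (he : right_basis e) a : {ffun 'I_m -> B} :=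
  xchoose (coords_subproof he a).

Lemma coordsP e (he : right_basis e) a :
  a = \sum_(i < m) e i * f (coords he a i).
Proof. exact/eqP/(xchooseP (coords_subproof he a)). Qed.

Lemma coords_uniq e (he : right_basis e) a b :
  a = \sum_(i < m) e i * f (b i) -> coords he a = b.
Proof.
move=> hb; have [c [_ hc]] := he a.
by rewrite -(hc _ hb) -(hc _ (coordsP he a)).
Qed.

Definition lreg e (he : right_basis e) a : 'M[B]_m :=
  \matrix_(i, j) coords he (a * e j) i.

Lemma lregP e (he : right_basis e) a j :
  a * e j = \sum_(i < m) e i * f (lreg he a i j).
Proof.
by rewrite {1}(coordsP he (a * e j)); apply: eq_bigr => i _; rewrite mxE.
Qed.

End FreeRightModule.

(* M(r, B) is the subring of M(r, A) with inclusion map_mx f. *)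
Lemma scalar_right_basis (A B : pzRingType) (f : B -> A) (m r : nat)
    (e : 'I_m -> A) :
  right_basis f e ->
  right_basis (map_mx f : 'M[B]_r -> 'M[A]_r) (fun i => (e i)%:M).
Proof.
move=> he M.
have entry (b : {ffun 'I_m -> 'M[B]_r}) p q :
    (\sum_(i < m) (e i)%:M * map_mx f (b i) : 'M[A]_r) p q =
    \sum_(i < m) e i * f ([ffun i => b i p q] i).
  rewrite summxE; apply: eq_bigr => i _.
  by rewrite -[_ * _]/(_ *m _) mul_scalar_mx !mxE ffunE.
exists [ffun i => \matrix_(p, q) coords he (M p q) i]; split=> [|b hb].
  apply/matrixP=> p q; rewrite entry {1}(coordsP he (M p q)).
  by apply: eq_bigr => i _; rewrite !ffunE mxE.
apply/ffunP=> i; rewrite ffunE; apply/matrixP=> p q; rewrite mxE.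
rewrite (@coords_uniq _ _ _ _ _ he _ [ffun i => b i p q]) ?ffunE //.
by rewrite hb entry.
Qed.

(* m x m matrices over M(r, B) viewed as matrices over B; the library type of *)
(* block matrices has size \sum_(i < m) r, which equals m * r.                *)
Definition flatten_mx (B : pzRingType) (m r : nat) (M : 'M['M[B]_r]_m) :
    'M[B]_(\sum_(i < m) r) :=
  \mxblock_(i < m, j < m) M i j.

Definition Sdet (A : pzRingType) (B : comPzRingType) (f : B -> A) (m r : nat)
    (E : 'I_m -> 'M[A]_r)
    (E_basis : right_basis (map_mx f : 'M[B]_r -> 'M[A]_r) E) (a : 'M[A]_r) :
    B :=
  \det (flatten_mx (lreg E_basis a)).

Definition row_addition (A : pzRingType) (r : nat) (a a' : 'M[A]_r) : Prop :=
  exists i k : 'I_r, exists x : A, i != k /\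
    a' = \matrix_(p, q) (if p == i then a i q + x * a k q else a p q).

Definition col_addition (A : pzRingType) (r : nat) (a a' : 'M[A]_r) : Prop :=
  exists j k : 'I_r, exists x : A, j != k /\
    a' = \matrix_(p, q) (if q == j then a p j + a p k * x else a p q).

(* Main.v *)
Require Import Defs.
From mathcomp Require Import all_boot all_order all_algebra.
Import GRing.Theory.
Local Open Scope ring_scope.

(** Both kinds of operation multiply [a] by some [1 + x E_ik] with [i != k]. The
    left regular representation is a unital ring morphism for any basis, so Sdet
    is multiplicative and inherits det (1 + UV) = det (1 + VU). As
    [x E_ik = E_ii (x E_ik)] while [(x E_ik) E_ii = 0], it follows that
    [Sdet (1 + x E_ik) = Sdet 1 = 1]. *)

Section RegularRepresentation.

Context {A B : pzRingType} {f : {rmorphism B -> A}} {m : nat}.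
Context {e : 'I_m -> A} (he : right_basis f e).

(** Coordinates in a basis are unique, so the defining relation of the regular representation
    determines it; the ring laws below are verified through this relation alone. *)
Lemma lreg_uniq a (M : 'M[B]_m) :
  (forall j, a * e j = \sum_(i < m) e i * f (M i j)) -> lreg he a = M.
Proof.
move=> hM; apply/matrixP=> i j; rewrite mxE.
rewrite (@coords_uniq _ _ _ _ _ he _ [ffun i => M i j]) ?ffunE // hM.
by apply: eq_bigr => k _; rewrite ffunE.
Qed.

Lemma lregD a b : lreg he (a + b) = lreg he a + lreg he b.
Proof.
apply: lreg_uniq => j; rewrite mulrDl !(Defs.lregP he) -big_split /=.
by apply: eq_bigr => i _; rewrite [in RHS]mxE rmorphD mulrDr.
Qed.

Lemma lregM a b : lreg he (a * b) = lreg he a *m lreg he b.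
Proof.
apply: lreg_uniq => j; rewrite -mulrA (Defs.lregP he b) mulr_sumr.
(* Scalars stay to the right of the basis vectors, so associativity suffices and [f] need not have
   central image. *)
under eq_bigr do rewrite mulrA (Defs.lregP he a) mulr_suml.
rewrite exchange_big /=; apply: eq_bigr => i _.
rewrite [in RHS]mxE rmorph_sum mulr_sumr; apply: eq_bigr => k _.
by rewrite rmorphM mulrA.
Qed.

Lemma lreg1 : lreg he 1 = 1%:M.
Proof.
apply: lreg_uniq => j; rewrite mul1r (bigD1 j) //= big1 => [|i /negPf ij].
  by rewrite mxE eqxx rmorph1 mulr1 addr0.
by rewrite mxE ij rmorph0 mulr0.
Qed.

End RegularRepresentation.

Section Flatten.

Context {B : pzRingType} {m r : nat}.
Implicit Types M N : 'M['M[B]_r]_m.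

Lemma flatten_mxD M N : flatten_mx (M + N) = flatten_mx M + flatten_mx N.
Proof.
by rewrite /flatten_mx -mxblockD; apply: eq_mxblock => i j; rewrite mxE.
Qed.

Lemma flatten_mxM M N : flatten_mx (M *m N) = flatten_mx M *m flatten_mx N.
Proof.
by rewrite /flatten_mx mul_mxblock; apply: eq_mxblock => i j; rewrite mxE.
Qed.

Lemma flatten_mx1 : flatten_mx (1%:M : 'M['M[B]_r]_m) = 1%:M.
Proof.
rewrite -mxdiagZ; apply: eq_mxblock => i j; rewrite mxE.
(* All blocks have size [r], so the size cast on the diagonal blocks is trivial. *)
by case: eqP => // _; rewrite conform_mx_id.
Qed.

End Flatten.

(** Sylvester's determinant identity: both sides arise from block triangular factorizations of the
    matrix with rows [1, -U] and [V, 1]. *)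
Lemma det_add1_mulmxC (R : comPzRingType) (n p : nat)
    (U : 'M[R]_(n, p)) (V : 'M[R]_(p, n)) :
  \det (1%:M + U *m V) = \det (1%:M + V *m U).
Proof.
have: block_mx (1%:M + U *m V) (- U) 0 1%:M *m block_mx 1%:M 0 V 1%:M =
      block_mx 1%:M 0 V 1%:M *m block_mx 1%:M (- U) 0 (1%:M + V *m U).
  rewrite !mulmx_block !(mulmx0, mul0mx, mulmx1, mul1mx, addr0, add0r).
  by rewrite mulNmx mulmxN addrK addrCA addNr addr0.
move/(congr1 determinant).
by rewrite !det_mulmx !det_ublock !det_lblock !det1 !(mulr1, mul1r).
Qed.

Section StudyDeterminant.

Context {A : pzRingType} {B : comPzRingType} {f : {rmorphism B -> A}}.
Context {m r : nat} {E : 'I_m -> 'M[A]_r}.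
Variable E_basis : right_basis (map_mx f : 'M[B]_r -> 'M[A]_r) E.

Lemma SdetM a b : Sdet E_basis (a * b) = Sdet E_basis a * Sdet E_basis b.
Proof. by rewrite /Sdet lregM flatten_mxM det_mulmx. Qed.

Lemma Sdet1 : Sdet E_basis 1 = 1.
Proof. by rewrite /Sdet lreg1 flatten_mx1 det1. Qed.

Lemma Sdet_add1_mulC a b : Sdet E_basis (1 + a * b) = Sdet E_basis (1 + b * a).
Proof.
rewrite /Sdet !lregD !lregM lreg1 !flatten_mxD !flatten_mxM flatten_mx1.
exact: det_add1_mulmxC.
Qed.

(** The flattened matrix of a transvection need not be triangular, as the basis is arbitrary;
    swapping two factors avoids computing it. *)
Lemma Sdet_transvection i k (x : A) :
  i != k -> Sdet E_basis (1 + x *: delta_mx i k) = 1.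
Proof.
move=> ik; have -> : x *: delta_mx i k = delta_mx i i * (x *: delta_mx i k).
  rewrite -[_ * _]/(_ *m _); apply/matrixP=> p q; rewrite !mxE (bigD1 i) //=.
  rewrite big1 => [|j /negPf ji]; last by rewrite !mxE ji andbF mul0r.
  by rewrite !mxE eqxx andbT addr0; case: (p == i); rewrite ?mul1r ?mul0r ?mulr0.
rewrite Sdet_add1_mulC -[_ * _]/(_ *m _) -scalemxAl mul_delta_mx_0.
  by rewrite scaler0 addr0 Sdet1.
by rewrite eq_sym.
Qed.

End StudyDeterminant.

Lemma row_additionE {A : pzRingType} {r : nat} {a a' : 'M[A]_r} :
  row_addition a a' ->
  exists (i k : 'I_r) (x : A), i != k /\ a' = (1 + x *: delta_mx i k) * a.
Proof.
move=> [i [k [x [ik ->]]]]; exists i, k, x; split=> //.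
rewrite mulrDl mul1r -[_ * _]/(_ *m _); apply/matrixP=> p q.
(* Only the summand at [k] survives, and it contributes to row [i] alone. *)
rewrite !mxE (bigD1 k) //= big1 => [|j /negPf jk].
  by rewrite !mxE eqxx andbT addr0; case: eqP => [->|_];
    rewrite ?mulr1 // mulr0 mul0r addr0.
by rewrite !mxE jk andbF mulr0 mul0r.
Qed.

Lemma col_additionE {A : pzRingType} {r : nat} {a a' : 'M[A]_r} :
  col_addition a a' ->
  exists (k j : 'I_r) (x : A), k != j /\ a' = a * (1 + x *: delta_mx k j).
Proof.
(* For right multiplication the source column [k] is the row index of the matrix unit, hence the
   reversed order of the witnesses. *)
move=> [j [k [x [jk ->]]]]; exists k, j, x; split; first by rewrite eq_sym.
rewrite mulrDr mulr1 -[_ * _]/(_ *m _); apply/matrixP=> p q.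
rewrite !mxE (bigD1 k) //= big1 => [|l /negPf lk].
  by rewrite !mxE eqxx /= addr0; case: eqP => [->|_];
    rewrite ?mulr1 // !mulr0 addr0.
by rewrite !mxE lk /= !mulr0.
Qed.

Theorem lemma6p3 (B : comPzRingType) (A : pzRingType)
    (f : {rmorphism B -> A}) (f_inj : injective f)
    (m : nat) (A_free : free_right_rank f m)
    (r : nat) (r_ge1 : (1 <= r)%N)
    (E : 'I_m -> 'M[A]_r)
    (E_basis : right_basis (map_mx f : 'M[B]_r -> 'M[A]_r) E)
    (a a' : 'M[A]_r)
    (a'_from_a : row_addition a a' \/ col_addition a a') :
  Sdet E_basis a' = Sdet E_basis a.
Proof.
case: a'_from_a => [/row_additionE|/col_additionE] [i [k [x [ik ->]]]].
  by rewrite SdetM Sdet_transvection // mul1r.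
by rewrite SdetM Sdet_transvection // mulr1.
Qed.
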